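(* Let $K$ be a field, $S=K[x_1,\dots,x_n]$, and let $I\subset S$ be an unmixed monomial ideal generated in degree $d$. If $I$ is of König type, then its polarization $I^{\wp}$ is very well-covered.
   Context: A graded ideal $I\subset S$ of height $h$ is of König type if there exist a sequence $f_1,\dots,f_h$ of homogeneous polynomials forming part of a minimal system of generators of $I$ and a monomial order $<$ such that the initial monomials $\operatorname{in}_<(f_1),\dots,\operatorname{in}_<(f_h)$ form a regular sequence. $I$ is unmixed if all associated primes of $I$ have the same height. $G(I)$ is the minimal set of monomial generators of $I$. For a monomial $u=\prod_{i=1}^n x_i^{a_i}$ put $u^{\wp}=\prod_{i=1}^n\prod_{j=1}^{a_i}x_{ij}$; the polarization $I^{\wp}$ is the squarefree monomial ideal generated by the $u^{\wp}$, $u\in G(I)$, in a polynomial ring over $K$ in the variables $x_{ij}$. A squarefree monomial ideal $I$ generated in degree $d$ is called very well-covered if $\left|\bigcup_{u\in G(I)}\operatorname{Supp}(u)\right|=(\operatorname{height} I)\,d$, where $\operatorname{Supp}(u)$ is the set of variables dividing $u$. *)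

(* Defs.v *)
From HB Require Import structures.
From mathcomp Require Import all_boot all_order all_algebra.
From mathcomp Require Import boolp.
From mathcomp Require Export mpoly.

Set Implicit Arguments.
Unset Strict Implicit.
Unset Printing Implicit Defensive.

Import GRing.Theory.

Local Open Scope ring_scope.

(* Ideals are collective predicates compared with =i. Arbitrary (undecidable) *)
(* sets are made boolean by `[< _ >], so quantifying over {pred R} is          *)
(* quantifying over all subsets of R.                                          *)

Section Rings.

Variable R : comNzRingType.
Implicit Types (I P : {pred R}) (s : seq R).

Definition ideal_gen (B : {pred R}) : {pred R} :=
  [pred p | `[< exists2 s : seq (R * R),
                  all (fun x => x.2 \in B) s & p = \sum_(x <- s) x.1 * x.2 >]].

(* idealr_closed contains properness: 1 \notin P. *)
Definition prime_ideal P := idealr_closed P /\ prime_idealr_closed P.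

Definition prime_chain P k := exists c : nat -> {pred R},
  [/\ forall i, (i <= k)%N -> prime_ideal (c i),
      forall i, (i < k)%N -> {subset c i <= c i.+1} /\
                             exists2 p, p \in c i.+1 & p \notin c i
    & c k =i P].

Definition prime_height P h :=
  prime_chain P h /\ forall k, prime_chain P k -> (k <= h)%N.

(* The infimum of the heights of the primes containing I; a prime without a   *)
(* finite height does not contribute, and the unit ideal has no height.       *)
Definition height I h :=
  (exists P, [/\ prime_ideal P, {subset I <= P} & prime_height P h]) /\
  forall P k, prime_ideal P -> {subset I <= P} -> prime_height P k -> (h <= k)%N.

Definition associated_prime I P :=
  prime_ideal P /\ exists f, forall g, (g \in P) = (f * g \in I).

Definition unmixed I :=
  exists h, forall P, associated_prime I P -> prime_height P h.

Definition regular_sequence s :=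
  (forall i a, (i < size s)%N ->
     s`_i * a \in ideal_gen (mem (take i s)) -> a \in ideal_gen (mem (take i s))) /\
  1 \notin ideal_gen (mem s).

Definition minimal_generators I s :=
  I =i ideal_gen (mem s) /\
  forall i, (i < size s)%N -> ~ (I =i ideal_gen (mem (take i s ++ drop i.+1 s))).

End Rings.

Section Monomials.

Variables (K : fieldType) (n : nat).
Local Notation S := {mpoly K[n]}.
Implicit Types (I : {pred S}) (B : {pred 'X_{1..n}}) (u v w : 'X_{1..n}).

Definition homogeneous (p : S) := exists d, p \is d.-homog.

Definition generated_in_degree I d := exists2 B : {pred S},
  (forall p, p \in B -> p \is d.-homog) & I =i ideal_gen B.

Definition monomials B : {pred S} :=
  [pred p | `[< exists2 u, u \in B & p = 'X_[u] >]].

Definition monomial_ideal I := exists B, I =i ideal_gen (monomials B).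

Definition squarefree u := [forall i, (u i <= 1)%N].

Definition squarefree_monomial_ideal I := exists2 B : {pred 'X_{1..n}},
  (forall u, u \in B -> squarefree u) & I =i ideal_gen (monomials B).

(* G(I) as the monomials of I that are minimal for divisibility; see          *)
(* min_gens_generate and min_gens_least.                                      *)
Definition min_gens I : {pred 'X_{1..n}} :=
  [pred u | ('X_[u] \in I) &&
            `[< forall v, 'X_[v] \in I -> (v <= u)%MM -> v = u >]].

Definition monomial_order (le : rel 'X_{1..n}) :=
  [/\ [/\ reflexive le, antisymmetric le, transitive le & total le],
      forall u, le 0%MM u
    & forall u v w, le u v -> le (u + w)%MM (v + w)%MM].

(* The le-largest monomial of the support of p (0%MM if p = 0). *)
Definition initial_mnm (le : rel 'X_{1..n}) (p : S) : 'X_{1..n} :=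
  foldr (fun u v => if le u v then v else u) 0%MM (msupp p).

Definition konig_type I := exists h, height I h /\
  exists f : h.-tuple S,
  [/\ forall i, homogeneous (tnth f i),
      exists2 g : seq S, (forall p, p \in g -> homogeneous p) &
                         minimal_generators I (f ++ g)
    & exists2 le : rel 'X_{1..n}, monomial_order le &
        regular_sequence [seq 'X_[K, initial_mnm le p] | p <- f]].

Definition mnm_supp u : {set 'I_n} := [set i | u i != 0%N].

Definition gens_supp I : {set 'I_n} :=
  [set i | `[< exists2 u, u \in min_gens I & i \in mnm_supp u >]].

Definition very_well_covered I d :=
  [/\ squarefree_monomial_ideal I,
      generated_in_degree I d
    & exists2 h, height I h & #|gens_supp I| = (h * d)%N].

End Monomials.

(* The variable x_{ij} (i < n, j < m) is the one of index mxvec_index i j;    *)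
(* polarize u is the intended u^\wp when all exponents of u are at most m.    *)
Definition polarize n m (u : 'X_{1..n}) : 'X_{1..n * m} :=
  (\sum_(i < n) \sum_(j < m | (j < u i)%N) U_(mxvec_index i j))%MM.

Definition polarization (K : fieldType) n m (I : {pred {mpoly K[n]}}) :
    {pred {mpoly K[n * m]}} :=
  ideal_gen (monomials
    [pred v | `[< exists2 u, u \in min_gens I & v = polarize m u >]]).

Arguments polarization {K n} m I.

Section MinGens.

Variables (K : fieldType) (n : nat).
Implicit Types (I : {pred {mpoly K[n]}}) (B : {pred 'X_{1..n}}).

Lemma mem_ideal_gen (R : comNzRingType) (B : {pred R}) p :
  p \in B -> p \in ideal_gen B.
Proof.
move=> Bp; apply/asboolP; exists [:: (1, p)]; first by rewrite /= Bp.
by rewrite big_seq1 mul1r.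
Qed.

Lemma ideal_gen_min (R : comNzRingType) (B C : {pred R}) :
  {subset B <= ideal_gen C} -> {subset ideal_gen B <= ideal_gen C}.
Proof.
move=> sBC p /asboolP[s Bs ->]; elim: s Bs => [|[a b] s IHs] /=.
  by move=> _; rewrite big_nil; apply/asboolP; exists [::]; rewrite ?big_nil.
case/andP=> /sBC/asboolP[t Ct def_b] /IHs/asboolP[t' Ct' def_s].
rewrite big_cons def_s /= def_b mulr_sumr; apply/asboolP.
exists ([seq (a * x.1, x.2) | x <- t] ++ t'); last first.
  by rewrite big_cat big_map /=; congr (_ + _); apply: eq_bigr => x; rewrite mulrA.
by rewrite all_cat Ct' andbT all_map.
Qed.

Lemma mem_monomial_ideal B u :
  'X_[K, u] \in ideal_gen (monomials B) -> exists2 v, v \in B & (v <= u)%MM.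
Proof.
move=> /asboolP[s Bs def_u].
have : u \in msupp (\sum_(x <- s) x.1 * x.2) by rewrite -def_u msuppX mem_seq1.
elim: s Bs {def_u} => [|[a b] s IHs] /=; first by rewrite big_nil msupp0.
case/andP=> /asboolP[v Bv /= ->] /IHs{}IHs; rewrite big_cons /=.
move=> /msuppD_le; rewrite mem_cat => /orP[|/IHs//].
rewrite mcoeff_msupp; case: (boolP (v <= u)%MM) => [le_vu _|nle]; first by exists v.
rewrite (_ : (a * 'X_[v])@_u = 0) ?eqxx //; apply/eqP.
rewrite -[_ == 0]negbK -mcoeff_msupp; apply: contra nle => /msuppM_le.
move=> /allpairsP[[w1 w2] /= [_]]; rewrite msuppX inE => /eqP-> ->.
by rewrite addmC lem_addr.
Qed.

Lemma min_gens_below I u :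
  'X_[u] \in I -> exists2 v, v \in min_gens I & (v <= u)%MM.
Proof.
have [d] := ubnP (mdeg u); elim: d u => // d IHd u /ltnSE le_ud Iu.
have [mu|/asboolPn/existsNP[v /not_implyP[Iv /not_implyP[le_vu neq_vu]]]] :=
  boolP `[< forall v, 'X_[v] \in I -> (v <= u)%MM -> v = u >].
  by exists u; rewrite ?lepm_refl //; apply/andP.
have [|//|w Gw le_wv] := IHd v; last by exists w => //; apply: lepm_trans le_vu.
apply: leq_trans le_ud; rewrite -(submK le_vu) mdegD -[X in (X < _)%N]add0n.
rewrite ltn_add2r lt0n mdeg_eq0; apply/eqP=> uv0; apply: neq_vu.
by rewrite -(submK le_vu) uv0 add0m.
Qed.

Lemma min_gens_generate I :
  monomial_ideal I -> I =i ideal_gen (monomials (min_gens I)).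
Proof.
case=> B defI p; rewrite defI; apply/idP/idP; apply: ideal_gen_min => {}p.
  case/asboolP=> u Bu ->.
  have [|v Gv le_vu] := @min_gens_below I u.
    by rewrite defI; apply/mem_ideal_gen/asboolP; exists u.
  apply/asboolP; exists [:: ('X_[u - v], 'X_[v])].
    by rewrite /= andbT; apply/asboolP; exists v.
  by rewrite big_seq1 /= -mpolyXD submK.
by case/asboolP=> u /andP[Iu _] ->; rewrite -defI.
Qed.

Lemma min_gens_least I B :
  I =i ideal_gen (monomials B) -> {subset min_gens I <= B}.
Proof.
move=> defI u /andP[]; rewrite defI => /mem_monomial_ideal[v Bv le_vu].
move=> /asboolP/(_ v _ le_vu) <- //.
by rewrite defI; apply/mem_ideal_gen/asboolP; exists v.
Qed.

End MinGens.

(* Main.v *)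
Require Import Defs.
From mathcomp Require Import all_boot all_order all_algebra.
From mathcomp Require Import boolp mpoly.

(** Let [u_1, ..., u_h], with [h] the height of [I], be the initial monomials of a
    Koenig sequence.  They are pairwise coprime elements of [G(I)]
    ([konig_min_gens]), so their polarizations have disjoint supports of size [d]
    each, which makes [h * d] variables.  It remains to see that the polarization
    has height [h], and that no other variable occurs in its generators, that is,
    that the exponent of a variable in an element of [G(I)] never exceeds its
    exponent in some [u_k].

    Both points come from the monomials [w] outside [I] that are maximal, where
    exponents from [m] on count as infinite.  For such [w], the colon ideal [I : w]
    is generated by the variables in [C = {j | w_j < m}]; it is thus an associated
    prime of height [#|C|] ([associated_prime_max]), and unmixedness forces
    [#|C| = h].  Each [u_k] exceeds [w] at some index of [C], and coprimality makes
    these [h] indices distinct, so every index of [C] is reached.  If [u] in [G(I)]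
    involves [x_i], a maximal [w] above [u / x_i] has [w_i = u_i - 1], so [i] is in [C]
    and some [u_k] has an exponent at least [u_i] there ([unmixed_exponent]).  The
    same monomials [w] give the primes generated by the [x_(i, w_i)], [i] in [C], over
    the polarization, of height [h]; a smaller height is impossible because of the
    [h] coprime monomials ([height_polarization]).

    Heights are defined by chains of primes, so all this rests on the fact that
    [c] variables generate a prime of height exactly [c]
    ([prime_height_var_ideal]).  Extending chains upwards reduces it to the bound
    [n] for the dimension of [K[x_1, ..., x_n]], which holds because elements
    climbing a chain of primes are algebraically independent
    ([chain_alg_independent]), whereas any [n + 1] polynomials in [n] variables are
    dependent by a dimension count ([algebraic_dependence]). *)

Set Implicit Arguments.
Unset Strict Implicit.
Unset Printing Implicit Defensive.

Import GRing.Theory.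

Local Open Scope ring_scope.

(** * Prime ideals of a commutative ring *)

Section PrimeIdeals.

Variable R : comNzRingType.
Implicit Types (P : {pred R}).

Lemma prime_ideal0 P : prime_ideal P -> 0 \in P.
Proof. by case=> -[]. Qed.

Lemma prime_ideal1 P : prime_ideal P -> 1 \notin P.
Proof. by case=> -[]. Qed.

Lemma prime_idealD P a b : prime_ideal P -> a \in P -> b \in P -> a + b \in P.
Proof. by case=> -[_ _ clP] _ Pa Pb; rewrite -[a]mul1r; apply: clP. Qed.

Lemma prime_idealMl P a b : prime_ideal P -> b \in P -> a * b \in P.
Proof. by case=> -[P0 _ clP] _ Pb; rewrite -[_ * b]addr0; apply: clP. Qed.

Lemma prime_idealMr P a b : prime_ideal P -> a \in P -> a * b \in P.
Proof. by move=> prP Pa; rewrite mulrC; apply: prime_idealMl. Qed.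

Lemma prime_idealDr P a b : prime_ideal P -> b \in P -> (a + b \in P) = (a \in P).
Proof.
move=> prP Pb; apply/idP/idP=> [Pab|Pa]; last exact: prime_idealD.
by rewrite -(addrK b a) -mulN1r; apply: prime_idealD => //; apply: prime_idealMl.
Qed.

Lemma prime_ideal_sum P (J : Type) (r : seq J) (Q : pred J) (F : J -> R) :
  prime_ideal P -> (forall j, Q j -> F j \in P) -> \sum_(j <- r | Q j) F j \in P.
Proof.
move=> prP PF; apply: (big_ind (fun x => x \in P)) => //; first exact: prime_ideal0.
by move=> a b; apply: prime_idealD.
Qed.

Lemma prime_idealM P a b : prime_ideal P -> (a * b \in P) = (a \in P) || (b \in P).
Proof.
move=> prP; apply/idP/orP=> [/(proj2 prP)/orP//|[]]; last exact: prime_idealMl.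
exact: prime_idealMr.
Qed.

Lemma prime_idealX P a k : prime_ideal P -> a ^+ k \in P -> a \in P.
Proof.
move=> prP; elim: k => [|k IHk]; first by rewrite expr0 (negPf (prime_ideal1 prP)).
by rewrite exprS prime_idealM // => /orP[].
Qed.

Lemma prime_ideal_prod P (J : Type) (r : seq J) (F : J -> R) :
  prime_ideal P -> \prod_(j <- r) F j \in P -> exists j, F j \in P.
Proof.
move=> prP; elim: r => [|j r IHr].
  by rewrite big_nil (negPf (prime_ideal1 prP)).
by rewrite big_cons prime_idealM // => /orP[Pj|/IHr//]; exists j.
Qed.

End PrimeIdeals.

(** * The Krull dimension of a polynomial ring *)

Section Dimension.

Variables (K : fieldType) (n : nat).
Local Notation S := {mpoly K[n]}.

Lemma prime_idealZ (P : {pred S}) (a : K) p : prime_ideal P -> a != 0 ->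
  (a *: p \in P) = (p \in P).
Proof.
move=> prP nz_a; rewrite -mul_mpolyC prime_idealM // orb_idl // => Pa.
case/negP: (prime_ideal1 prP); rewrite -mpolyC1 -(mulVf nz_a) mpolyCM.
exact: prime_idealMl.
Qed.

(** Elements that climb a chain of primes, with [f j] in [c j.+1] but not in
    [c j], are algebraically independent.  In a polynomial relation, keep at
    stage [i] the terms whose exponents are least in the first [i] coordinates,
    taken lexicographically.  Modulo [c i] a power of [f i] can be cancelled
    from these terms, and those where [f i] still occurs then vanish modulo
    [c i.+1].  Only one term survives after the last stage, so a nonzero scalar
    would lie in a proper ideal.  The relation is a family indexed by [T] so
    that no polynomial ring in the [f j] is needed. *)
Lemma chain_alg_independent (k : nat) (c : nat -> {pred S}) (f : 'I_k -> S)
    (T : finType) (e : T -> 'I_k -> nat) (a : T -> K) :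
  (forall i, (i <= k)%N -> prime_ideal (c i)) ->
  (forall i, (i < k)%N -> {subset c i <= c i.+1}) ->
  (forall j : 'I_k, f j \in c j.+1 /\ f j \notin c j) ->
  (forall t1 t2, e t1 =1 e t2 -> t1 = t2) ->
  (exists t, a t != 0) ->
  \sum_t a t *: \prod_j f j ^+ e t j != 0.
Proof.
move=> pr_c sub_c f_c inj_e [t0 nz_t0].
pose G i (A : {set T}) := \sum_(t in A) a t *: \prod_(j < k | (i <= j)%N) f j ^+ e t j.
(* The stages are counted downwards by l = k - i; A holds the terms kept at
   stage i. *)
suff notin l i (A : {set T}) : (i + l = k)%N ->
    (forall t1 t2, t1 \in A -> t2 \in A -> forall j : 'I_k, (j < i)%N -> e t1 j = e t2 j) ->
    (exists t, t \in A) -> (forall t, t \in A -> a t != 0) ->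
    G i A \notin c i.
  have := notin k 0 [set t | a t != 0] (erefl _); rewrite /G.
  have -> : \sum_(t in [set t | a t != 0]) a t *: \prod_(j < k | (0 <= j)%N) f j ^+ e t j =
      \sum_t a t *: \prod_j f j ^+ e t j.
    rewrite big_mkcond; apply: eq_bigr => t _; rewrite inE.
    by case: eqP => //= ->; rewrite scale0r.
  move=> h; apply: contraTneq (prime_ideal0 (pr_c 0%N isT)) => <-; apply: h => //.
    by exists t0; rewrite ?inE.
  by move=> t; rewrite inE.
elim: l i A => [|l IHl] i A.
  rewrite addn0 => -> eq_A [t At] nz_A.
  suff -> : A = [set t].
    rewrite /G big_set1 big1 => [|j]; last by rewrite leqNgt ltn_ord.
    by rewrite prime_idealZ ?nz_A ?prime_ideal1 //; apply: pr_c.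
  apply/setP=> t'; rewrite inE; apply/idP/eqP=> [At'|->//].
  by apply: inj_e => j; apply: eq_A.
move=> def_k eq_A [t1 At1] nz_A.
have lt_ik : (i < k)%N by rewrite -def_k addnS ltnS leq_addr.
pose o := Ordinal lt_ik; have [fo1 fo0] := f_c o.
(* b is the power of f i that can be cancelled, B the set of terms in which
   nothing of f i is left after that. *)
pose b := e [arg min_(t < t1 in A) e t o] o.
have [t2 At2 [def_b min_b]] :
    exists2 t2, t2 \in A & e t2 o = b /\ forall t, t \in A -> (b <= e t o)%N.
  rewrite /b; case: (arg_minnP (fun t => e t o) At1) => t2 At2 min_t2.
  by exists t2.
have /= pr_i := pr_c i (ltnW lt_ik); have /= pr_i1 := pr_c i.+1 lt_ik.
pose B := [set t in A | e t o == b].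
have split_prod t : \prod_(j < k | (i <= j)%N) f j ^+ e t j =
    f o ^+ e t o * \prod_(j < k | (i.+1 <= j)%N) f j ^+ e t j.
  rewrite (bigD1 o) //=; congr (_ * _); apply: eq_bigl => j.
  by rewrite ltn_neqAle andbC eq_sym.
pose H := \sum_(t in A)
  a t *: (f o ^+ (e t o - b) * \prod_(j < k | (i.+1 <= j)%N) f j ^+ e t j).
have def_G : G i A = f o ^+ b * H.
  rewrite /G /H mulr_sumr; apply: eq_bigr => t At.
  by rewrite split_prod -scalerAr mulrA -exprD subnKC ?min_b.
rewrite def_G prime_idealM //; apply/norP; split.
  by apply: contra fo0; apply: prime_idealX.
have : G i.+1 B \notin c i.+1.
  apply: IHl; rewrite ?addSnnS //.
  - move=> t t'; rewrite !inE => /andP[At /eqP et] /andP[At' /eqP et'] j.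
    rewrite ltnS leq_eqVlt => /orP[/eqP def_j|]; last exact: eq_A.
    have -> : j = o by apply/val_inj.
    by rewrite et et'.
  - by exists t2; rewrite inE At2 def_b /=.
  by move=> t; rewrite inE => /andP[/nz_A].
apply: contra => /(sub_c i lt_ik); rewrite /H (bigID (fun t => e t o == b)) /=.
rewrite prime_idealDr //; last first.
  apply: prime_ideal_sum => // t /andP[At neq_b].
  rewrite -mul_mpolyC; apply: prime_idealMl => //; apply: prime_idealMr => //.
  have : (0 < e t o - b)%N by rewrite subn_gt0 ltn_neqAle eq_sym neq_b min_b.
  by case: (e t o - b)%N => // q _; rewrite exprS; apply: prime_idealMr.
rewrite /G -(eq_bigl _ _ (fun t => in_set (fun t => (t \in A) && (e t o == b)) t)).
rewrite [X in X \in _ -> _](eq_bigr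
  (fun t => a t *: \prod_(j < k | (i.+1 <= j)%N) f j ^+ e t j)) //.
by move=> t; rewrite inE => /andP[_ /eqP->]; rewrite subnn expr0 mul1r.
Qed.

Lemma msuppM_mdeg (p q : S) a b :
  {in msupp p, forall u, mdeg u <= a}%N -> {in msupp q, forall u, mdeg u <= b}%N ->
  {in msupp (p * q), forall u, mdeg u <= a + b}%N.
Proof.
move=> dp dq u /msuppM_le/allpairsP[[v w] /= [pv qw ->]].
by rewrite mdegD leq_add ?dp ?dq.
Qed.

(** Counting: the products of the [f j] with exponents below [M] are [M ^ n.+1]
    in number, while their own exponents stay below a multiple [M * B] of [M],
    which leaves room for [(M * B) ^ n] monomials only.  As soon as [M] exceeds
    [B ^ n], the products outnumber these monomials and are linearly
    dependent. *)
Lemma algebraic_dependence (f : 'I_n.+1 -> S) :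
  exists M (a : {ffun 'I_n.+1 -> 'I_M} -> K), (exists t, a t != 0) /\
    \sum_t a t *: \prod_j f j ^+ t j = 0.
Proof.
pose e := (\max_j msize (f j))%N.
pose B := (n.+1 * e.+1)%N; pose M := (B ^ n).+1; pose L := (M * B)%N.
pose g (t : {ffun 'I_n.+1 -> 'I_M}) := \prod_j f j ^+ t j.
have deg_f j : {in msupp (f j), forall u, mdeg u <= e}%N.
  by move=> u /msize_mdeg_lt/ltnW/leq_trans; apply; apply: (leq_bigmax j).
have deg_exp j q : {in msupp (f j ^+ q), forall u, mdeg u <= q * e}%N.
  elim: q => [|q IHq] u; first by rewrite expr0 msupp1 inE => /eqP->; rewrite mdeg0.
  by rewrite exprS mulSn; apply: msuppM_mdeg.
have deg_g t : {in msupp (g t), forall u, mdeg u < L}%N.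
  have : {in msupp (g t), forall u, mdeg u <= \sum_(j < n.+1) t j * e}%N.
    rewrite /g; apply: (big_ind2 (fun (p : S) a => {in msupp p, forall u, mdeg u <= a}%N)).
    - by move=> u; rewrite msupp1 inE => /eqP->; rewrite mdeg0.
    - by move=> p1 a1 p2 a2; apply: msuppM_mdeg.
    by move=> j _; apply: deg_exp.
  move=> dg u /dg/leq_ltn_trans; apply.
  apply: (@leq_ltn_trans (\sum_(j < n.+1) M * e)%N).
    by apply: leq_sum => j _; rewrite leq_mul2r ltnW ?orbT.
  by rewrite sum_nat_const card_ord /L /B mulnCA ltn_pmul2l // ltn_pmul2l //.
pose U := {ffun 'I_n -> 'I_L}; pose T := {ffun 'I_n.+1 -> 'I_M}.
(* Row t of A lists the coefficients of g t on the monomials with exponents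
   below L; a vector of the row kernel is a linear relation. *)
pose mu (s : U) : 'X_{1..n} := [multinom (s i : nat) | i < n].
pose A : 'M[K]_(#|T|, #|U|) := \matrix_(i, j) (g (enum_val i))@_(mu (enum_val j)).
have : kermx A != 0.
  rewrite kermx_eq0 /row_free neq_ltn (leq_ltn_trans (rank_leq_col _)) //.
  by rewrite !card_ffun !card_ord /L expnMn expnSr ltn_pmul2l ?expn_gt0.
case/rowV0Pn=> v /submxP[w def_v] nz_v.
have vA0 : v *m A = 0 by rewrite def_v -mulmxA mulmx_ker mulmx0.
exists M, (fun t => v 0 (enum_rank t)); split.
  have [j nz_j] : exists j, v 0 j != 0.
    apply/existsP; rewrite -[[exists _, _]]negbK negb_exists.
    apply: contra nz_v => /forallP v0; apply/eqP/rowP=> j; rewrite mxE.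
    exact/eqP/negPn/v0.
  by exists (enum_val j); rewrite enum_valK.
apply/mpolyP=> u; rewrite mcoeff0 raddf_sum /=.
have [/existsP[i big_i]|/existsPn small_u] := boolP [exists i, L <= u i]%N.
  rewrite big1 // => t _; rewrite mcoeffZ memN_msupp_eq0 ?mulr0 //.
  apply: contraL big_i => /deg_g; rewrite mdegE (bigD1 i) //= -ltnNge.
  by apply: leq_ltn_trans; apply: leq_addr.
have lt_u i : (u i < L)%N by rewrite ltnNge small_u.
pose s : U := [ffun i => Ordinal (lt_u i)].
have def_u : u = mu s by apply/mnmP=> i; rewrite mnmE ffunE.
transitivity ((v *m A) 0 (enum_rank s)); last by rewrite vA0 mxE.
rewrite mxE (reindex_onto (@enum_val T T) enum_rank) /=; last first.
  by move=> t _; rewrite enum_rankK.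
apply: eq_big => [i|i _]; first by rewrite enum_valK eqxx.
by rewrite mcoeffZ mxE enum_valK enum_rankK -def_u.
Qed.

(** A longer chain would provide [n.+1] algebraically independent elements. *)
Lemma prime_chain_leq (P : {pred S}) k : prime_chain P k -> (k <= n)%N.
Proof.
case=> c [pr_c sub_c _]; rewrite leqNgt; apply/negP=> lt_nk.
have lt_k (i : 'I_n.+1) : (i < k)%N by apply: leq_trans (ltn_ord i) lt_nk.
have /fin_all_exists[f f_c] (i : 'I_n.+1) : exists p, p \in c i.+1 /\ p \notin c i.
  by have [_ [p p1 p0]] := sub_c i (lt_k i); exists p.
have [M [a [nz_a /eqP]]] := algebraic_dependence f.
apply/negP; apply: (@chain_alg_independent _ c) => //.
- by move=> i le_i; apply: pr_c; apply: leq_trans lt_nk.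
- by move=> i lt_i; case: (sub_c i) => //; apply: leq_trans lt_nk.
by move=> t1 t2 eq_t; apply/ffunP=> j; apply/val_inj/eq_t.
Qed.

End Dimension.

(** * Primes generated by variables *)

Section VariableIdeals.

Variables (K : fieldType) (n : nat).
Local Notation S := {mpoly K[n]}.
Implicit Types (C D : {set 'I_n}) (P : {pred S}) (u v : 'X_{1..n}).

Definition kill_vars C : n.-tuple S := [tuple if i \in C then 0 else 'X_i | i < n].

(** The ideal generated by the variables in [C], given as the kernel of the
    substitution that kills them: this makes primality immediate. *)
Definition var_ideal C : {pred S} := [pred p | p \mPo kill_vars C == 0].

Lemma kill_varsX C u :
  'X_[K, u] \mPo kill_vars C = if [disjoint C & mnm_supp u] then 'X_[u] else 0.
Proof.
rewrite comp_mpolyX; case: ifPn => [dis|].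
  rewrite [RHS]mpolyXE_id; apply: eq_bigr => i _; rewrite tnth_mktuple.
  case: ifP => // Ci; have := disjointFr dis Ci.
  by rewrite inE => /negbFE/eqP->; rewrite !expr0.
rewrite -setI_eq0 => /set0Pn[i /setIP[Ci]]; rewrite inE => nz_ui.
by rewrite (bigD1 i) //= tnth_mktuple Ci expr0n (negPf nz_ui) mul0r.
Qed.

Lemma mem_var_ideal C p :
  (p \in var_ideal C) = all (fun u => ~~ [disjoint C & mnm_supp u]) (msupp p).
Proof.
have def_k : p \mPo kill_vars C =
    \sum_(u <- msupp p | [disjoint C & mnm_supp u]) p@_u *: 'X_[u].
  rewrite comp_mpolyEX [RHS]big_mkcond; apply: eq_bigr => u _ /=.
  by rewrite kill_varsX; case: ifP; rewrite ?scaler0.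
rewrite inE def_k -big_filter -msupp_eq0 -size_eq0.
rewrite (perm_size (@msupp_sumX n K _ (fun u => p@_u) _ _)).
- by rewrite size_filter -leqn0 leqNgt -has_count -all_predC.
- by rewrite filter_uniq ?msupp_uniq.
by move=> u; rewrite mem_filter mcoeff_msupp => /andP[].
Qed.

Lemma mem_var_idealX C u :
  ('X_[u] \in var_ideal C) = ~~ [disjoint C & mnm_supp u].
Proof. by rewrite mem_var_ideal msuppX /= andbT. Qed.

Lemma mem_var_idealXU C i : ('X_i \in var_ideal C) = (i \in C).
Proof.
rewrite mem_var_idealX -setI_eq0; apply/set0Pn/idP=> [[j]|Ci].
  by rewrite !inE mnm1E eqb0 negbK => /andP[Cj /eqP->].
by exists i; rewrite !inE Ci mnm1E eqxx.
Qed.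

Lemma prime_var_ideal C : prime_ideal (var_ideal C).
Proof.
split; last by move=> p q; rewrite !inE rmorphM mulf_eq0.
split=> [||a p q]; rewrite !inE ?rmorph0 ?rmorph1 ?oner_eq0 //.
by move=> /eqP p0 /eqP q0; rewrite rmorphD rmorphM /= p0 q0 mulr0 addr0.
Qed.

Lemma var_ideal_subset C D : C \subset D -> {subset var_ideal C <= var_ideal D}.
Proof.
move=> sCD p; rewrite !mem_var_ideal; apply: sub_all => u.
by apply: contra; apply: disjointWl.
Qed.

Lemma mpolyX_dvd_var u i : i \in mnm_supp u -> 'X_[K, u] = 'X_[u - U_(i)] * 'X_i.
Proof.
by rewrite inE -lep1mP => le_iu; rewrite -mpolyXD submK.
Qed.

Lemma var_ideal_least C P :
  prime_ideal P -> (forall i, i \in C -> 'X_i \in P) -> {subset var_ideal C <= P}.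
Proof.
move=> prP PC p; rewrite mem_var_ideal [p in p \in P]mpolyE => /allP all_p.
rewrite big_seq; apply: prime_ideal_sum => // u /all_p.
rewrite -setI_eq0 => /set0Pn[i /setIP[Ci ui]].
by rewrite (mpolyX_dvd_var ui) scalerAl; apply: prime_idealMl (PC i Ci).
Qed.

Lemma prime_ideal_var P u :
  prime_ideal P -> 'X_[u] \in P -> exists2 i, i \in mnm_supp u & 'X_i \in P.
Proof.
move=> prP; rewrite mpolyXE_id.
have [/existsP[i /andP[ui Pi]]|/existsPn no_i] :=
  boolP [exists i, (i \in mnm_supp u) && ('X_i \in P)]; first by exists i.
case/(prime_ideal_prod prP)=> i Pi; have := no_i i; rewrite inE negb_and negbK.
case/orP=> [/eqP u0|/negP[]]; last exact: prime_idealX Pi.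
by move: Pi; rewrite u0 expr0 (negPf (prime_ideal1 prP)).
Qed.

(** The chain adds the variables of [C] one at a time, with [P] itself in the last
    place instead of the full [var_ideal C]. *)
Lemma prime_chain_vars C P :
  prime_ideal P -> (forall i, i \in C -> 'X_i \in P) -> prime_chain P #|C|.
Proof.
move=> prP PC; pose A k := [set i in take k (enum C)].
have sAC k : A k \subset C.
  by apply/subsetP=> i; rewrite inE => /mem_take; rewrite mem_enum.
exists (fun k => if (k < #|C|)%N then var_ideal (A k) else P).
split=> [k _|k lt_k|]; last by rewrite ltnn.
  by case: ifP => // _; apply: prime_var_ideal.
rewrite lt_k; have [i0 _] : exists i, i \in C.
  by apply/set0Pn; rewrite -card_gt0 (leq_trans _ lt_k).
have lt_k' : (k < size (enum C))%N by rewrite -cardE.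
have Ci : nth i0 (enum C) k \in C by rewrite -mem_enum mem_nth.
have take_k : take k.+1 (enum C) = rcons (take k (enum C)) (nth i0 (enum C) k).
  by rewrite (take_nth i0).
have nAi : nth i0 (enum C) k \notin A k.
  rewrite inE; have := take_uniq k.+1 (enum_uniq C).
  by rewrite take_k rcons_uniq => /andP[].
split.
  case: ifP => _; last by apply: var_ideal_least => // i /(subsetP (sAC k))/PC.
  apply: var_ideal_subset; apply/subsetP=> i; rewrite !inE take_k mem_rcons inE.
  by move->; rewrite orbT.
exists 'X_(nth i0 (enum C) k); last by rewrite mem_var_idealXU.
case: ifP => _; last exact: PC.
by rewrite mem_var_idealXU inE take_k mem_rcons inE eqxx.
Qed.

Lemma prime_chain_extend P Q k :
  prime_chain P k -> prime_ideal Q -> {subset P <= Q} ->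
  (exists2 p, p \in Q & p \notin P) -> prime_chain Q k.+1.
Proof.
case=> c [pr_c inc_c def_P] prQ sPQ [p Qp nPp].
exists (fun i => if (i <= k)%N then c i else Q); split=> [i _|i|]; last by rewrite ltnn.
  by case: ifP => [/pr_c|].
rewrite ltnS => le_ik; rewrite le_ik; case: ltnP => [/inc_c//|le_ki].
have -> : i = k by apply/eqP; rewrite eqn_leq le_ik.
by split=> [q|]; rewrite ?def_P; [apply: sPQ | exists p; rewrite ?def_P].
Qed.

(** A chain ending in [var_ideal C] extends by adding the other variables one by
    one, so its length cannot exceed [#|C|] when no chain is longer than [n]. *)
Lemma prime_height_var_ideal C : prime_height (var_ideal C) #|C|.
Proof.
split; first by apply: prime_chain_vars (prime_var_ideal C) _ => i; rewrite mem_var_idealXU.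
have [q] := ubnP #|~: C|; elim: q C => // q IHq C lt_q k chain_k.
have [C0|[i]] := set_0Vmem (~: C).
  by rewrite -[C]setCK C0 setC0 cardsT card_ord; apply: prime_chain_leq chain_k.
rewrite inE => nCi; rewrite -ltnS.
have <- : #|i |: C| = #|C|.+1 by rewrite cardsU1 nCi.
apply: IHq.
  rewrite -ltnS; apply: leq_trans lt_q; rewrite ltnS; apply: proper_card; rewrite properE.
  rewrite setCS subsetUr setCS; apply: contra nCi => /subsetP; apply.
  by rewrite !inE eqxx.
apply: prime_chain_extend chain_k (prime_var_ideal _) _ _.
  exact/var_ideal_subset/subsetUr.
by exists 'X_i; rewrite mem_var_idealXU ?inE ?eqxx.
Qed.

Lemma prime_height_unique P k l : prime_height P k -> prime_height P l -> k = l.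
Proof.
by move=> [ch_k max_k] [ch_l max_l]; apply/eqP; rewrite eqn_leq max_l ?max_k.
Qed.

End VariableIdeals.

(** * Generated ideals *)

Section IdealGen.

Variable R : comNzRingType.
Implicit Types (B : {pred R}).

Lemma ideal_gen0 B : 0 \in ideal_gen B.
Proof. by apply/asboolP; exists [::]; rewrite ?big_nil. Qed.

Lemma ideal_genD B a b : a \in ideal_gen B -> b \in ideal_gen B -> a + b \in ideal_gen B.
Proof.
move=> /asboolP[s Bs ->] /asboolP[t Bt ->]; apply/asboolP; exists (s ++ t).
  by rewrite all_cat Bs.
by rewrite big_cat.
Qed.

Lemma ideal_genMl B a b : b \in ideal_gen B -> a * b \in ideal_gen B.
Proof.
move=> /asboolP[s Bs ->]; apply/asboolP; exists [seq (a * x.1, x.2) | x <- s].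
  by rewrite all_map.
by rewrite big_map mulr_sumr; apply: eq_bigr => x _; rewrite mulrA.
Qed.

Lemma ideal_gen_sum B (J : eqType) (r : seq J) (F : J -> R) :
  (forall j, j \in r -> F j \in ideal_gen B) -> \sum_(j <- r) F j \in ideal_gen B.
Proof.
move=> BF; rewrite big_seq; apply: (big_ind (fun x => x \in ideal_gen B)) => //.
  exact: ideal_gen0.
exact: ideal_genD.
Qed.

Lemma ideal_gen_sub B C : {subset B <= C} -> {subset ideal_gen B <= ideal_gen C}.
Proof. by move=> sBC; apply: ideal_gen_min => p /sBC; apply: mem_ideal_gen. Qed.

Lemma prime_ideal_gen (P B : {pred R}) :
  prime_ideal P -> {subset B <= P} -> {subset ideal_gen B <= P}.
Proof.
move=> prP sBP p /asboolP[s Bs ->]; rewrite big_seq; apply: prime_ideal_sum => // x.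
by move=> /(allP Bs)/sBP; apply: prime_idealMl.
Qed.

End IdealGen.

(** * Monomial ideals, initial monomials and degrees *)

Section MonomialIdeals.

Variables (K : fieldType) (n : nat).
Local Notation S := {mpoly K[n]}.
Implicit Types (I : {pred S}) (u v w : 'X_{1..n}).

Lemma monomial_ideal_le I u v :
  monomial_ideal I -> 'X_[u] \in I -> (u <= v)%MM -> 'X_[v] \in I.
Proof.
case=> B defI; rewrite !defI => Iu le_uv.
by rewrite -(submK le_uv) mpolyXD; apply: ideal_genMl.
Qed.

Lemma mem_monomial_idealE I p :
  monomial_ideal I -> (p \in I) = all (fun u => 'X_[u] \in I) (msupp p).
Proof.
move=> monI; have [B defI] := monI; apply/idP/allP=> [|all_p].
  rewrite defI => /asboolP[s Bs ->] u /msupp_sum_le/flatten_mapP[x].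
  rewrite filter_predT => /(allP Bs)/asboolP[v Bv ->] /msuppM_le.
  case/allpairsP=> [[w1 w2] /= [_]]; rewrite msuppX inE => /eqP-> ->.
  apply: (monomial_ideal_le monI) (lem_addl w1 v).
  by rewrite defI; apply/mem_ideal_gen/asboolP; exists v.
rewrite defI [p in p \in _]mpolyE; apply: ideal_gen_sum => u /all_p.
by rewrite defI -mul_mpolyC; apply: ideal_genMl.
Qed.

(** The exponents above [m] play the role of infinite ones when [m] bounds those
    of the generators, so [w] is a monomial outside [I] that cannot be increased
    in any direction where it is finite. *)
Lemma max_notin I m v : 'X_[v] \notin I ->
  exists w, [/\ (v <= w)%MM, 'X_[w] \notin I
              & forall j, (w j < m)%N -> 'X_[w + U_(j)] \in I].
Proof.
have [q] := ubnP (\sum_i (m - v i))%N; elim: q v => // q IHq v lt_q nIv.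
have [/forallP max_v|/forallPn[j]] :=
  boolP [forall j, (v j < m)%N ==> ('X_[v + U_(j)] \in I)].
  by exists v; split=> [||j]; [apply: lepm_refl | | apply/implyP/max_v].
rewrite negb_imply => /andP[lt_j nIvj]; case: (IHq _ _ nIvj) => [|w [le_w nIw max_w]].
  rewrite -ltnS; apply: leq_trans lt_q; rewrite ltnS.
  rewrite (bigD1 j) //= [X in (_ < X)%N](bigD1 j) //=.
  rewrite -addSn leq_add //.
    by rewrite mnmDE mnm1E eqxx addn1 subnS prednK // subn_gt0.
  by apply: leq_sum => i _; rewrite mnmDE leq_sub2l // leq_addr.
by exists w; split=> //; apply: lepm_trans le_w; apply: lem_addr.
Qed.

(** The prime is [I : 'X_[w]].  Where [w j < m], multiplication by ['X_j] leads into
    [I].  In the other directions [w] already dominates every generator, so no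
    monomial in these variables moves ['X_[w]] into [I]. *)
Lemma associated_prime_max I m w :
    monomial_ideal I -> (forall u, u \in min_gens I -> forall i, u i <= m)%N ->
    'X_[w] \notin I -> (forall j, (w j < m)%N -> 'X_[w + U_(j)] \in I) ->
  associated_prime I (var_ideal [set j | w j < m]%N).
Proof.
move=> monI le_m nIw max_w; split; first exact: prime_var_ideal.
exists 'X_[w] => g; rewrite mem_var_ideal mem_monomial_idealE // mulrC.
rewrite (perm_all _ (msuppMX _ _)) [RHS]all_map; apply: eq_all => u /=.
apply/idP/idP=> [|/min_gens_below[v Gv le_v]].
  rewrite -setI_eq0 => /set0Pn[j]; rewrite !inE => /andP[/max_w Iwj nz_uj].
  apply: (monomial_ideal_le monI Iwj); apply/mnm_lepP=> i.
  by rewrite !mnmDE leq_add2l mnm1E; case: eqP => // <-; rewrite lt0n.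
apply: contra nIw => dis; have /andP[Iv _] := Gv.
apply: (monomial_ideal_le monI Iv); apply/mnm_lepP=> i.
have [lt_i|/(leq_trans _)->//] := ltnP (w i) m; last exact: le_m.
have := disjointFr dis; move/(_ i); rewrite !inE => /(_ lt_i)/negbFE/eqP u0.
by have /mnm_lepP/(_ i) := le_v; rewrite mnmDE u0 addn0.
Qed.

(** If ['X_t] divided two members [u_i] and [u_j], then [u_j * (u_i / 'X_t)] would be
    a multiple of [u_i], and regularity at [j] gives an earlier [u_l] dividing
    [u_i / 'X_t].  Then [l != i], so by induction [u_l] is coprime to [u_i] while
    dividing it: [u_l] is [1], which a regular sequence excludes. *)
Lemma regular_sequence_coprime (s : seq 'X_{1..n}) i j :
    regular_sequence [seq 'X_[K, u] | u <- s] -> (i < j < size s)%N ->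
  [disjoint mnm_supp (nth 0%MM s i) & mnm_supp (nth 0%MM s j)].
Proof.
pose X := [seq 'X_[K, u] | u <- s] => -[reg_s proper_s] /andP[].
have memX v k : 'X_[K, v] \in ideal_gen (mem (take k X)) ->
    exists2 l, (l < k)%N && (l < size s)%N & (nth 0%MM s l <= v)%MM.
  rewrite /X -map_take => Iv.
  have : 'X_[K, v] \in ideal_gen (monomials (mem (take k s))).
    apply: ideal_gen_sub Iv => p /mapP[u us ->]; by apply/asboolP; exists u.
  case/mem_monomial_ideal=> u /(nthP 0%MM)[l]; rewrite size_take_min leq_min.
  by move=> lt_l <- le_v; exists l => //; case/andP: lt_l => ? _; rewrite nth_take in le_v.
have nz k : (k < size s)%N -> nth 0%MM s k != 0%MM.
  move=> lt_k; apply: contra proper_s => /eqP s0; apply: mem_ideal_gen.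
  by apply/mapP; exists (nth 0%MM s k); rewrite ?mem_nth // s0 mpolyX0.
have [q] := ubnP j; elim: q i j => // q IHq i j le_jq lt_ij lt_js.
rewrite -setI_eq0; apply: contraT => /set0Pn[t /setIP[si_t sj_t]].
have : 'X_[nth 0%MM s i - U_(t)] \in ideal_gen (mem (take j X)).
  apply: (reg_s j); rewrite ?size_map // (nth_map 0%MM) //.
  rewrite (mpolyX_dvd_var _ sj_t) -mulrA -mpolyXD addmC submK; last first.
    by rewrite lep1mP; rewrite inE in si_t.
  apply/ideal_genMl/mem_ideal_gen; rewrite -map_take; apply/mapP.
  exists (nth 0%MM s i) => //; rewrite -(nth_take 0%MM lt_ij) mem_nth //.
  by rewrite size_take_min leq_min lt_ij (ltn_trans lt_ij).
case/memX=> l /andP[lt_lj lt_ls] le_l.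
have le_li : (nth 0%MM s l <= nth 0%MM s i)%MM by apply: lepm_trans le_l (lem_subr _ _).
have [eq_li|neq_li] := eqVneq l i.
  have /mnm_lepP/(_ t) := le_l; rewrite eq_li mnmBE mnm1E eqxx leqNgt.
  by rewrite ltn_subrL /= lt0n; rewrite inE in si_t; rewrite si_t.
have dis : [disjoint mnm_supp (nth 0%MM s l) & mnm_supp (nth 0%MM s i)].
  move: neq_li; rewrite neq_ltn => /orP[lt|lt]; [|rewrite disjoint_sym].
    by apply: IHq => //; [apply: leq_trans lt_ij _ | apply: ltn_trans lt_ij _].
  by apply: IHq => //; apply: leq_trans lt_lj _.
case/eqP: (nz l lt_ls); apply/mnmP=> k; rewrite mnm0E; apply/eqP/negPn/negP=> nz_k.
have := disjointFr dis; move/(_ k); rewrite !inE => /(_ nz_k)/negbFE/eqP sik.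
by have /mnm_lepP/(_ k) := le_li; rewrite sik leqn0 (negPf nz_k).
Qed.

(** The second case, which the zero polynomial realizes, yields the monomial [1];
    a regular sequence cannot contain it. *)
Lemma initial_mnm_supp (le : rel 'X_{1..n}) (p : S) :
  initial_mnm le p \in msupp p \/ initial_mnm le p = 0%MM.
Proof.
rewrite /initial_mnm; elim: (msupp p) => [|u s IHs] /=; first by right.
case: ifP => _; last by left; apply: mem_head.
by case: IHs => [su|]; [left; rewrite inE su orbT | right].
Qed.

Lemma msupp_generated I d p u :
    generated_in_degree I d -> p \in I -> u \in msupp p ->
  exists v b, [/\ b \in I, v \in msupp b, mdeg v = d & (v <= u)%MM].
Proof.
case=> B homB defI; rewrite defI => /asboolP[s Bs ->] /msupp_sum_le/flatten_mapP[x].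
rewrite filter_predT => /(allP Bs) Bx /msuppM_le/allpairsP[[w v] /= [_ xv ->]].
exists v, x.2; split=> //; last exact: lem_addl.
  by rewrite defI; apply: mem_ideal_gen.
by have /dhomogP/(_ _ xv) := homB _ Bx.
Qed.

Lemma mdeg_ge_generated I d u :
  generated_in_degree I d -> 'X_[u] \in I -> (d <= mdeg u)%N.
Proof.
move=> degI Iu; have [||v [b [_ _ <- le_v]]] := @msupp_generated I d 'X_[u] u degI.
- by [].
- by rewrite msuppX mem_head.
by rewrite -(submK le_v) mdegD leq_addl.
Qed.

Lemma mnm_le_mdeg u v : (u <= v)%MM -> (mdeg v <= mdeg u)%N -> u = v.
Proof.
move=> le_uv; rewrite -{1 2}(submK le_uv) mdegD -{2}[mdeg u]add0n leq_add2r leqn0.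
by rewrite mdeg_eq0 => /eqP->; rewrite add0m.
Qed.

(** All monomials of [I] have degree at least [d], so those of degree [d] are minimal
    for divisibility. *)
Lemma mem_min_gens_deg I d u : generated_in_degree I d ->
  'X_[u] \in I -> (mdeg u <= d)%N -> u \in min_gens I.
Proof.
move=> degI Iu du; apply/andP; split=> //; apply/asboolP=> v Iv le_v.
apply: mnm_le_mdeg => //; apply: leq_trans du _; exact: mdeg_ge_generated degI Iv.
Qed.

Lemma mdeg_min_gens I d u : monomial_ideal I -> generated_in_degree I d ->
  u \in min_gens I -> mdeg u = d.
Proof.
move=> monI degI /andP[Iu /asboolP min_u].
have [||v [b [Ib bv dv le_v]]] := @msupp_generated I d 'X_[u] u degI.
- by [].
- by rewrite msuppX mem_head.
by rewrite -(min_u v) //; move: Ib; rewrite mem_monomial_idealE // => /allP->.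
Qed.

Lemma pihomogMl d e (a g : S) : g \is e.-homog ->
  exists b, pihomog mdeg d (a * g) = b * g.
Proof.
move=> hom_g; exists (\sum_(u <- msupp a | (mdeg u + e == d)%N) a@_u *: 'X_[u]).
rewrite {1}[a]mpolyE mulr_suml raddf_sum mulr_suml [RHS]big_mkcond.
apply: eq_bigr => u _ /=; rewrite -scalerAl linearZ /=.
have hom_ug : 'X_[u] * g \is (mdeg u + e).-homog by rewrite dhomogM ?dhomogX.
by case: eqP => [<-|/eqP neq]; [rewrite pihomog_dE | rewrite (pihomog_ne0 neq) ?scaler0 ?mul0r].
Qed.

Lemma pihomogM_gt d e (a g : S) : g \is e.-homog -> (d < e)%N ->
  pihomog mdeg d (a * g) = 0.
Proof.
move=> /dhomogP hom_g lt_de; rewrite pihomogE big_seq_cond big_pred0 // => u.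
apply/negP=> /andP[/msuppM_le/allpairsP[[v w] /= [_ /hom_g dw ->]]].
by rewrite mdegD dw; apply/negP; rewrite gtn_eqF // (leq_trans lt_de) ?leq_addl.
Qed.

(** The degree [d] part of a combination of the generators does not involve the
    generators of degree above [d]; as [I] is generated by elements of degree [d],
    such a generator would be redundant. *)
Lemma minimal_generators_deg I d (s : seq S) i e :
    generated_in_degree I d -> minimal_generators I s ->
    (forall p, p \in s -> homogeneous p) -> (i < size s)%N -> s`_i \is e.-homog ->
  (e <= d)%N.
Proof.
move=> [B homB defB] [defI min_s] hom_s lt_i hom_i; rewrite leqNgt; apply/negP=> lt_de.
pose t := take i s ++ drop i.+1 s; case: (min_s i lt_i) => p.
apply/idP/idP; last first.
  rewrite defI; apply: ideal_gen_sub => {}p; rewrite mem_cat.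
  by case/orP=> [/mem_take|/mem_drop].
rewrite defB; apply: ideal_gen_min => {}p Bp.
have : p \in I by rewrite defB mem_ideal_gen.
rewrite defI => /asboolP[r sr def_p].
rewrite -(pihomog_dE (homB p Bp)) def_p raddf_sum /=; apply: ideal_gen_sum => x /(allP sr) sx.
have [tx|ntx] := boolP (x.2 \in t).
  have [k hom_x] := hom_s _ sx; have [b ->] := pihomogMl d x.1 hom_x.
  exact/ideal_genMl/mem_ideal_gen.
suff -> : x.2 = s`_i by rewrite (pihomogM_gt _ hom_i) ?ideal_gen0.
have : x.2 \in take i s ++ drop i s by rewrite cat_take_drop.
rewrite (drop_nth 0) // mem_cat inE.
move: ntx; rewrite mem_cat negb_or => /andP[/negPf-> /negPf->].
by rewrite orbF => /eqP.
Qed.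

End MonomialIdeals.

(** * Unmixed monomial ideals of Koenig type *)

Section Konig.

Variables (K : fieldType) (n : nat).
Local Notation S := {mpoly K[n]}.
Implicit Types (I : {pred S}) (u v w : 'X_{1..n}).

(** The initial monomials of the Koenig sequence.  The [f_i] have degree [d], being
    part of a minimal system of generators, and the monomials of their supports
    belong to the monomial ideal [I]; so the initial monomials are in [G(I)], and a
    regular sequence of monomials is pairwise coprime. *)
Lemma konig_min_gens I d :
    monomial_ideal I -> generated_in_degree I d -> konig_type I ->
  exists h (us : 'I_h -> 'X_{1..n}),
    [/\ height I h, forall k, us k \in min_gens I
      & forall k l, k != l -> [disjoint mnm_supp (us k) & mnm_supp (us l)]].
Proof.
move=> monI degI [h [hI [f [hom_f [g hom_g min_fg] [le _ reg_f]]]]].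
pose us (k : 'I_h) := initial_mnm le (tnth f k).
pose s := [seq initial_mnm le p | p <- f].
have size_s : size s = h by rewrite size_map size_tuple.
have def_us k : us k = nth 0%MM s k.
  by rewrite (nth_map 0) ?size_tuple // -tnth_nth.
rewrite [map _ _](map_comp (fun u => 'X_[K, u])) -/s in reg_f.
exists h, us; split=> // [k|k l neq_kl]; last first.
  wlog lt_kl: k l {neq_kl} / (k < l)%N => [dis|].
    move: neq_kl; rewrite -val_eqE neq_ltn => /orP[/dis//|/dis].
    by rewrite disjoint_sym.
  rewrite !def_us; apply: regular_sequence_coprime reg_f _.
  by rewrite lt_kl size_s /=.
have f_k : us k \in msupp (tnth f k).
  have [//|u0] := initial_mnm_supp le (tnth f k).
  case: reg_f => _ /negP[]; apply: mem_ideal_gen; apply/mapP; exists (us k).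
    by rewrite def_us mem_nth ?size_s.
  by rewrite /us u0 mpolyX0.
have If : tnth f k \in I.
  have [-> _] := min_fg; apply: mem_ideal_gen.
  by have : tnth f k \in (f : seq S) ++ g by rewrite mem_cat mem_tnth.
have Iu : 'X_[us k] \in I by move: If; rewrite mem_monomial_idealE // => /allP->.
apply: (mem_min_gens_deg degI Iu).
have [e hom_k] := hom_f k; rewrite (dhomog_mf hom_k) //.
apply: (@minimal_generators_deg _ _ I d (f ++ g) k e degI) => //.
- by move=> p; rewrite mem_cat => /orP[/tnthP[l ->]|/hom_g].
- by rewrite size_cat size_tuple ltn_addr.
by rewrite nth_cat size_tuple ltn_ord -tnth_nth.
Qed.

Section Unmixed.

Variables (I : {pred S}) (m h : nat).
Hypothesis monI : monomial_ideal I.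
Hypothesis le_m : forall u, u \in min_gens I -> forall i, (u i <= m)%N.
Hypothesis hI : height I h.

Lemma sub_var_ideal_max w :
    'X_[w] \notin I -> (forall j, (w j < m)%N -> 'X_[w + U_(j)] \in I) ->
  {subset I <= var_ideal [set j | w j < m]%N}.
Proof.
move=> nIw max_w p; have [_ [f ->]] := associated_prime_max monI le_m nIw max_w.
by have [B defI] := monI; rewrite !defI; apply: ideal_genMl.
Qed.

Lemma height_leq_card (C : {set 'I_n}) : {subset I <= var_ideal C} -> (h <= #|C|)%N.
Proof.
by case: hI => _ min_h sIC; apply: min_h sIC (prime_height_var_ideal _ C); apply: prime_var_ideal.
Qed.

(** Let [P] be a prime of height [h] over [I] and [C] the set of its variables, so
    [#|C| <= h].  Enlarging the monomial that is [m] outside [C] and [0] on [C] gives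
    a prime over [I] generated by variables among [C]; it has at least [h] of them
    because the height of [I] is [h]. *)
Lemma height_var_ideal :
  exists w, [/\ 'X_[w] \notin I, forall j, (w j < m)%N -> 'X_[w + U_(j)] \in I
              & #|[set j | w j < m]%N| = h].
Proof.
have [[P [prP sIP [_ max_h]]] _] := hI.
pose C := [set i | 'X_i \in P].
have le_Ch : (#|C| <= h)%N.
  by apply/max_h/prime_chain_vars => // i; rewrite inE.
pose v := [multinom if i \in C then 0%N else m | i < n].
have nIv : 'X_[v] \notin I.
  apply/negP=> /sIP/(prime_ideal_var prP)[i]; rewrite inE mnmE => nz_v Pi.
  by rewrite inE Pi in nz_v.
have [w [/mnm_lepP le_vw nIw max_w]] := max_notin m nIv.
exists w; split=> //; apply/eqP; rewrite eqn_leq height_leq_card ?andbT; last first.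
  exact: sub_var_ideal_max.
apply: leq_trans le_Ch; apply/subset_leq_card/subsetP=> i; rewrite inE => lt_i.
by have := le_vw i; rewrite mnmE; case: ifP => // _; rewrite leqNgt lt_i.
Qed.

Hypothesis unmI : unmixed I.

Lemma unmixed_card w :
    'X_[w] \notin I -> (forall j, (w j < m)%N -> 'X_[w + U_(j)] \in I) ->
  #|[set j | w j < m]%N| = h.
Proof.
move=> nIw max_w; have [w0 [nIw0 max_w0 <-]] := height_var_ideal.
have [h0 ass_h0] := unmI.
have card_h0 w1 (nIw1 : 'X_[w1] \notin I) max_w1 :=
  prime_height_unique (prime_height_var_ideal K _)
    (ass_h0 _ (associated_prime_max monI le_m nIw1 max_w1)).
by rewrite !card_h0.
Qed.

(** Every [us k] must exceed [w] at some index of [C = {j | w j < m}], whenever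
    ['X_[w]] is a maximal monomial outside [I].  By coprimality these indices
    differ, and [#|C| = h] by unmixedness, so they fill [C].  For [w] above [u / 'X_i]
    the exponent [w i] is [u i - 1], hence [i] is in [C] and some [us k] exceeds [w]
    at [i]. *)
Lemma unmixed_exponent (us : 'I_h -> 'X_{1..n}) u i :
    (forall k, us k \in min_gens I) ->
    (forall k l, k != l -> [disjoint mnm_supp (us k) & mnm_supp (us l)]) ->
    u \in min_gens I -> (0 < u i)%N ->
  exists k, (u i <= us k i)%N.
Proof.
move=> G_us dis_us Gu ui_gt0; have /andP[Iu /asboolP min_u] := Gu.
have nIv : 'X_[u - U_(i)] \notin I.
  apply/negP=> /min_u/(_ (lem_subr _ _)) /mnmP/(_ i)/eqP.
  by rewrite mnmBE mnm1E eqxx ltn_eqF // ltn_subrL.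
have [w [/mnm_lepP le_vw nIw max_w]] := max_notin m nIv.
have notle v : 'X_[v] \in I -> exists j, (w j < v j)%N.
  move=> Iv; apply/existsP; apply: contraR nIw => /existsPn le_v.
  apply: (monomial_ideal_le monI Iv); apply/mnm_lepP=> j.
  by rewrite leqNgt le_v.
have lt_wi : (w i < u i)%N.
  have [j lt_j] := notle u Iu; have := le_vw j; rewrite mnmBE mnm1E.
  by case: eqP => [->//|_]; rewrite subn0 leqNgt lt_j.
have /fin_all_exists[js lt_js] k : exists j, (w j < us k j)%N.
  by apply: notle; have /andP[] := G_us k.
have inj_js : injective js.
  move=> k l eq_js; apply/eqP/contraT=> neq_kl.
  have := disjointFr (dis_us k l neq_kl); move/(_ (js k)); rewrite !inE -!lt0n.
  move=> /(_ (leq_ltn_trans (leq0n _) (lt_js k))) /negP[].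
  by rewrite eq_js; apply: leq_ltn_trans (lt_js l).
have def_C : [set js k | k : 'I_h] = [set j | w j < m]%N.
  apply/eqP; rewrite eqEcard (unmixed_card nIw max_w) card_imset // card_ord leqnn andbT.
  apply/subsetP=> _ /imsetP[k _ ->]; rewrite inE.
  by apply: leq_trans (lt_js k) (le_m (G_us k) _).
have : i \in [set js k | k : 'I_h].
  by rewrite def_C inE (leq_trans lt_wi) ?le_m.
case/imsetP=> k _ def_i; exists k.
have := le_vw i; rewrite mnmBE mnm1E eqxx leq_subLR add1n => /leq_trans; apply.
by rewrite def_i; apply: lt_js.
Qed.

End Unmixed.

End Konig.

(** * Polarization *)

Section Polarization.

Variables (K : fieldType) (n m : nat).
Local Notation S := {mpoly K[n]}.
Implicit Types (I : {pred S}) (u v w : 'X_{1..n}).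

Lemma mxvec_index_inj : injective (fun p : 'I_n * 'I_m => mxvec_index p.1 p.2).
Proof. by move=> [i j] [k l] /= /cast_ord_inj/enum_rank_inj. Qed.

Lemma polarizeE u i j : polarize m u (mxvec_index i j) = (j < u i)%N.
Proof.
rewrite /polarize mnm_sumE (bigD1 i) //= mnm_sumE [X in (_ + X)%N]big1 ?addn0 => [|k neq_ki].
  rewrite big_mkcond (bigD1 j) //= mnm1E eqxx big1 ?addn0 => [|l neq_lj].
    by case: ifP.
  case: ifP => // _; rewrite mnm1E (inj_eq mxvec_index_inj (i, l) (i, j)).
  by rewrite xpair_eqE (negPf neq_lj) andbF.
rewrite mnm_sumE big1 // => l _; rewrite mnm1E (inj_eq mxvec_index_inj (k, l) (i, j)).
by rewrite xpair_eqE (negPf neq_ki).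
Qed.

Lemma mem_supp_polarize u i j :
  (mxvec_index i j \in mnm_supp (polarize m u)) = (j < u i)%N.
Proof. by rewrite inE polarizeE eqb0 negbK. Qed.

Lemma squarefree_polarize u : squarefree (polarize m u).
Proof.
by apply/forallP=> t; case/mxvec_indexP: t => i j; rewrite polarizeE leq_b1.
Qed.

Lemma mdeg_polarize u : (forall i, u i <= m)%N -> mdeg (polarize m u) = mdeg u.
Proof.
move=> le_u; rewrite /polarize mdeg_sum [RHS]mdegE; apply: eq_bigr => i _.
rewrite mdeg_sum (eq_bigr (fun=> 1%N)) => [|j _]; last exact: mdeg1.
by rewrite -(big_ord_widen m (fun=> 1%N) (le_u i)) sum_nat_const card_ord muln1.
Qed.

Lemma card_supp_squarefree N (v : 'X_{1..N}) : squarefree v -> #|mnm_supp v| = mdeg v.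
Proof.
move/forallP=> sq_v; rewrite mdegE -sum1_card big_mkcond; apply: eq_bigr => t _ /=.
by rewrite inE; case: (v t) (sq_v t) => [|[]].
Qed.

Lemma mem_polarization I u : u \in min_gens I -> 'X_[polarize m u] \in polarization m I.
Proof.
move=> Gu; apply: mem_ideal_gen; apply/asboolP; exists (polarize m u) => //.
by apply/asboolP; exists u.
Qed.

Variables (I : {pred S}) (d h : nat) (us : 'I_h -> 'X_{1..n}).
Hypothesis monI : monomial_ideal I.
Hypothesis degI : generated_in_degree I d.
Hypothesis le_m : forall u, u \in min_gens I -> forall i, (u i <= m)%N.
Hypothesis G_us : forall k, us k \in min_gens I.
Hypothesis dis_us : forall k l, k != l -> [disjoint mnm_supp (us k) & mnm_supp (us l)].

Lemma generated_polarization : generated_in_degree (polarization m I) d.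
Proof.
eexists; last by move=> p; apply: erefl.
move=> p /asboolP[_ /asboolP[u Gu ->] ->].
by rewrite dhomogX /= mdeg_polarize ?(mdeg_min_gens monI degI Gu) //; apply: le_m.
Qed.

Lemma min_gens_polarization (v : 'X_{1..n * m}) :
  v \in min_gens (polarization m I) <-> exists2 u, u \in min_gens I & v = polarize m u.
Proof.
split=> [/(min_gens_least (fun=> erefl))/asboolP//|[u Gu ->]].
apply: mem_min_gens_deg generated_polarization (mem_polarization Gu) _.
by rewrite mdeg_polarize ?(mdeg_min_gens monI degI Gu) //; apply: le_m.
Qed.

Lemma disjoint_polarize k l : k != l ->
  [disjoint mnm_supp (polarize m (us k)) & mnm_supp (polarize m (us l))].
Proof.
move=> neq_kl; rewrite -setI_eq0; apply/eqP/setP=> t; rewrite in_setI in_set0.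
case/mxvec_indexP: t => i j; rewrite !mem_supp_polarize; apply/negP=> /andP[lt_k lt_l].
have := disjointFr (dis_us neq_kl); move/(_ i); rewrite !inE -!lt0n.
move=> /(_ (leq_ltn_trans (leq0n _) lt_k)) /negP[].
exact: leq_ltn_trans lt_l.
Qed.

(** The monomial [w] outside [I] turns into the prime generated by the variables
    [x_(i, w_i)] with [w_i < m]: a generator [u] of [I] has [w_i < u_i] for some [i], so
    that its polarization involves [x_(i, w_i)].  Conversely, a prime over the
    polarization contains a variable of each of the [h] coprime monomials
    [polarize m (us k)]. *)
Lemma height_polarization w :
    'X_[w] \notin I -> #|[set j | w j < m]%N| = h -> height (polarization m I) h.
Proof.
move=> nIw card_w; split=> [|P k prP sIP [_ max_k]].
  pose A := [set p : 'I_n * 'I_m | p.2 == w p.1 :> nat].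
  pose D := [set mxvec_index p.1 p.2 | p in A].
  have <- : #|D| = h.
    rewrite card_imset; last exact: mxvec_index_inj.
    have inj_A : {in A &, injective (fst : 'I_n * 'I_m -> 'I_n)}.
      move=> [i j] [k l]; rewrite !inE /= => /eqP eq_j /eqP eq_l eq_i.
      by move: eq_j; rewrite eq_i -eq_l => /val_inj->.
    rewrite -card_w -(card_in_imset inj_A); apply: eq_card => i.
    rewrite inE; apply/imsetP/idP=> [[[k j]]|lt_i].
      by rewrite inE /= => /eqP eq_j ->; rewrite -eq_j.
    by exists (i, Ordinal lt_i); rewrite ?inE.
  exists (var_ideal D); split; [exact: prime_var_ideal | | exact: prime_height_var_ideal].
  apply: prime_ideal_gen (prime_var_ideal _ D) _ => p /asboolP[_ /asboolP[u Gu ->] ->].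
  have [i lt_i] : exists i, (w i < u i)%N.
    apply/existsP; apply: contraR nIw => /existsPn le_u; have /andP[Iu _] := Gu.
    by apply: (monomial_ideal_le monI Iu); apply/mnm_lepP=> j; rewrite leqNgt le_u.
  have lt_m := leq_trans lt_i (le_m Gu i).
  rewrite mem_var_idealX -setI_eq0; apply/set0Pn.
  exists (mxvec_index i (Ordinal lt_m)); rewrite in_setI mem_supp_polarize lt_i andbT.
  by apply/imsetP; exists (i, Ordinal lt_m); rewrite ?inE.
have /fin_all_exists[t t_P] l : exists t, t \in mnm_supp (polarize m (us l)) /\ 'X_t \in P.
  by have [|t] := @prime_ideal_var _ _ P (polarize m (us l)) prP;
    [apply/sIP/mem_polarization | exists t].
have inj_t : injective t.
  move=> k1 k2 eq_t; apply/eqP/contraT=> /disjoint_polarize dis.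
  by have [st1 _] := t_P k1; have := disjointFr dis st1; rewrite eq_t; case: (t_P k2) => ->.
rewrite -[h]card_ord -(card_imset _ inj_t); apply/max_k/prime_chain_vars => // _ /imsetP[l _ ->].
by case: (t_P l).
Qed.

(** If every exponent of a generator is dominated by some [us k], then the supports of
    the polarized [us k] cover all the variables in use; they are disjoint, of size
    [d] each. *)
Lemma card_gens_supp_polarization :
    (forall u i, u \in min_gens I -> (0 < u i)%N -> exists k, (u i <= us k i)%N) ->
  #|gens_supp (polarization m I)| = (h * d)%N.
Proof.
move=> le_us.
have -> : gens_supp (polarization m I) = \bigcup_k mnm_supp (polarize m (us k)).
  apply/setP=> t; rewrite inE; apply/asboolP/bigcupP=> [[v]|[k _ st]]; last first.
    by exists (polarize m (us k)) => //; apply/min_gens_polarization; exists (us k).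
  case/min_gens_polarization=> u Gu ->; case/mxvec_indexP: t => i j.
  rewrite mem_supp_polarize => lt_j.
  have [k le_k] := le_us u i Gu (leq_ltn_trans (leq0n _) lt_j).
  by exists k; rewrite // mem_supp_polarize (leq_trans lt_j).
rewrite -sum1_card partition_disjoint_bigcup => [|k l]; last exact: disjoint_polarize.
rewrite (eq_bigr (fun=> d)) => [|k _]; first by rewrite sum_nat_const card_ord.
rewrite sum1_card card_supp_squarefree ?squarefree_polarize //.
by rewrite mdeg_polarize ?(mdeg_min_gens monI degI) //; apply: le_m.
Qed.

End Polarization.

Theorem theorem2p5 (K : fieldType) (n d : nat) (I : {pred {mpoly K[n]}})
    (hmon : monomial_ideal I) (hdeg : generated_in_degree I d)
    (hunm : unmixed I) (hkonig : konig_type I)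
    (m : nat) (hm : forall u : 'X_{1..n}, u \in min_gens I -> forall i, (u i <= m)%N) :
  very_well_covered (polarization m I) d.
Proof.
have [h [us [hI G_us dis_us]]] := konig_min_gens hmon hdeg hkonig.
have [w [nIw _ card_w]] := height_var_ideal hmon hm hI.
split.
- eexists; last by move=> p; apply: erefl.
  by move=> _ /asboolP[u _ ->]; apply: squarefree_polarize.
- exact: generated_polarization.
exists h; first exact: height_polarization card_w.
apply: (card_gens_supp_polarization hmon hdeg hm G_us dis_us) => u i Gu ui.
exact: (unmixed_exponent hmon hm hI hunm G_us dis_us Gu ui).
Qed.
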